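(* Let $1\le q<\infty$, $s>d/q$, $\kappa>0$, and let $u$ be the random function $$u(x)=\sum_{l=1}^\infty l^{-(\frac{s}{d}+\frac12-\frac1q)}\left(\tfrac1\kappa\right)^{\frac1q}\xi_l\,\psi_l(x),\qquad x\in\mathbb{T}^d,$$ where $\{\xi_l\}_{l\ge1}$ are real-valued i.i.d. random variables with probability density function proportional to $\exp(-\frac12|x|^q)$, and $\{\psi_l\}_{l\ge 1}$ is the wavelet basis of $L^2(\mathbb{T}^d)$ described in the context. Then for any $t<s-d/q$ there is a constant $r^*>0$, depending only on $q,d,s,t$, such that $$\mathbb{E}\left(\exp(\alpha\|u\|_{C^t})\right)<\infty\qquad\text{for all }\alpha\in\left(0,\frac{\kappa}{2r^*}\right).$$
   Context: $\mathbb{T}^d=(0,1]^d$ is the $d$-dimensional torus, $d\le3$. Wavelet basis: $\{\psi_l\}_{l\ge1}$ is a $\varrho$-regular orthonormal wavelet basis of $L^2(\mathbb{T}^d)$ with $\varrho>s$, i.e. the periodification of a wavelet basis of $L^2(\mathbb{R}^d)$ whose scaling function and mother wavelets $\bar\psi_m$ ($m=1,\dots,2^d-1$) are $\varrho$-regular; a function $f$ is $\varrho$-regular if $f\in C^\varrho$ and for every integer $m\in\mathbb{N}$ there is $C_m$ with $|\partial^\alpha f(x)|\le C_m(1+|x|)^{-m}$ for all multi-indices $|\alpha|\le\varrho$. The basis is ordered by increasing scale: $\psi_1$ is the (periodized) scaling function and, for $j\ge0$, the $\psi_l$ with $2^{jd}<l\le2^{(j+1)d}$ enumerate the scale-$j$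 functions $2^{jd/2}\sum_{n\in\mathbb{Z}^d}\bar\psi_m(2^j(x-n)-k)$, $1\le m\le 2^d-1$, $k\in\{0,\dots,2^j-1\}^d$. Norm: $C^t=C^t(\mathbb{T}^d)$ is the Hölder space, identified with the Besov space $B^t_{\infty,\infty}(\mathbb{T}^d)$, with norm expressed through the wavelet coefficients: for $f=\sum_l f_l\psi_l$, $\|f\|_{C^t}=\|f\|_{B^t_{\infty,\infty}}=\sup_{l\in\mathbb{N}} l^{\frac td+\frac12}|f_l|$. *)

(* Defs.v *)
From HB Require Import structures.
From mathcomp Require Import all_boot all_order all_algebra.
From mathcomp Require Import all_classical all_reals all_analysis.

Set Implicit Arguments.
Unset Strict Implicit.
Unset Printing Implicit Defensive.
Import Order.TTheory GRing.Theory Num.Theory.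
Import numFieldNormedType.Exports.

Local Open Scope classical_set_scope.
Local Open Scope ring_scope.

Definition measure_rV_display : measure_display -> measure_display.
Proof. exact. Qed.

Section measurable_rV.
Context {d} {T : measurableType d}.
Variable n : nat.

Let coors : 'I_n -> 'rV[T]_n -> T := fun i x => x ord0 i.

Let rV_set0 : g_sigma_preimage coors set0.
Proof. exact: sigma_algebra0. Qed.

Let rV_setC A : g_sigma_preimage coors A -> g_sigma_preimage coors (~` A).
Proof. exact: sigma_algebraC. Qed.

Let rV_bigcup (F : _^nat) : (forall i, g_sigma_preimage coors (F i)) ->
  g_sigma_preimage coors (\bigcup_i (F i)).
Proof. exact: sigma_algebra_bigcup. Qed.

(* The product sigma-algebra; over the reals it is the Borel sigma-algebra. *)
HB.instance Definition _ := @isMeasurable.Build (measure_rV_display d)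
  'rV[T]_n (g_sigma_preimage coors) rV_set0 rV_setC rV_bigcup.

End measurable_rV.

Section measurable_rV_theory.
Context d (T : measurableType d).

Lemma measurable_rV_coor n (i : 'I_n) :
  measurable_fun [set: 'rV[T]_n] (fun x => x ord0 i).
Proof.
move=> _ Y mY; rewrite setTI; apply: sub_sigma_algebra => /=.
rewrite -bigcup_seq/=; exists i => /=; first by rewrite mem_index_enum.
by exists Y => //; rewrite setTI.
Qed.

Lemma measurable_fun_rVP d' (S : measurableType d') n (f : S -> 'rV[T]_n) :
  (forall i, measurable_fun setT (fun s => f s ord0 i)) ->
  measurable_fun setT f.
Proof.
move=> mf _ Y mY; rewrite setTI.
suff : g_sigma_preimage (fun (i : 'I_n) (x : 'rV[T]_n) => x ord0 i)
    `<=` [set A | measurable (f @^-1` A)] by exact.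
apply: smallest_sub.
  split => /=.
  - by rewrite preimage_set0.
  - by move=> A mA; rewrite setTD preimage_setC; exact: measurableC.
  - move=> F mF; rewrite preimage_bigcup; exact: bigcupT_measurable.
rewrite -bigcup_seq => A [i _ [B mB <-]] /=.
by have := mf i measurableT B mB; rewrite !setTI.
Qed.

End measurable_rV_theory.

Section lebesgue_rV.
Variable R : realType.

Definition rV_cons n (p : R * 'rV[R]_n) : 'rV[R]_n.+1 :=
  \row_i oapp (p.2 ord0) p.1 (unlift ord0 i).

Definition rV_uncons n (x : 'rV[R]_n.+1) : R * 'rV[R]_n :=
  (x ord0 ord0, \row_i x ord0 (lift ord0 i)).

Lemma rV_cons_ord0 n (p : R * 'rV[R]_n) : rV_cons p ord0 ord0 = p.1.
Proof. by rewrite mxE unlift_none. Qed.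

Lemma rV_cons_lift n (p : R * 'rV[R]_n) (i : 'I_n) :
  rV_cons p ord0 (lift ord0 i) = p.2 ord0 i.
Proof. by rewrite mxE liftK. Qed.

Lemma rV_consK n : cancel (@rV_cons n) (@rV_uncons n).
Proof.
move=> p; rewrite /rV_uncons rV_cons_ord0 [RHS]surjective_pairing.
by congr pair; apply/rowP => i; rewrite mxE rV_cons_lift.
Qed.

Lemma measurable_rV_cons n : measurable_fun setT (@rV_cons n).
Proof.
apply: measurable_fun_rVP => i; case: (unliftP ord0 i) => [j ->|->].
- rewrite (_ : (fun _ => _) = (fun x : 'rV_n => x ord0 j) \o snd).
    by apply: measurableT_comp => //; exact: measurable_rV_coor.
  by apply/funext => p; rewrite rV_cons_lift.
- rewrite (_ : (fun _ => _) = fst); first exact: measurable_fst.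
  by apply/funext => p; rewrite rV_cons_ord0.
Qed.

Lemma measurable_rV_uncons n : measurable_fun setT (@rV_uncons n).
Proof.
apply: measurable_fun_pair; first exact: measurable_rV_coor.
apply: measurable_fun_rVP => i.
rewrite (_ : (fun _ => _) = (fun x : 'rV_n.+1 => x ord0 (lift ord0 i))).
  exact: measurable_rV_coor.
by apply/funext => x; rewrite mxE.
Qed.

Section step.
Local Open Scope ereal_scope.
Variables (n : nat) (mu : {sigma_finite_measure set 'rV[R]_n -> \bar R}).

Definition lebesgue_rV_step : set 'rV[R]_n.+1 -> \bar R :=
  pushforward (@lebesgue_measure R \x mu) (@rV_cons n).

Let prod := @lebesgue_measure R \x mu.

Let mpre (A : set 'rV[R]_n.+1) :
  measurable A -> measurable (@rV_cons n @^-1` A).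
Proof. by move=> mA; rewrite -[X in measurable X]setTI; exact: measurable_rV_cons. Qed.

Let step0 : lebesgue_rV_step set0 = 0.
Proof. by rewrite /lebesgue_rV_step /pushforward preimage_set0 measure0. Qed.

Let step_ge0 A : 0 <= lebesgue_rV_step A.
Proof. by apply: integral_ge0 => x _; exact: measure_ge0. Qed.

Let step_sigma_additive : semi_sigma_additive lebesgue_rV_step.
Proof.
move=> F mF tF mUF; rewrite /lebesgue_rV_step /pushforward preimage_bigcup.
apply: (@measure_semi_sigma_additive _ _ _ prod).
- by move=> k; exact: mpre.
- apply/trivIsetP => /= i j _ _ ij; rewrite -preimage_setI.
  by move/trivIsetP : tF => /(_ _ _ _ _ ij) ->//; rewrite preimage_set0.
- by rewrite -preimage_bigcup; exact: mpre.
Qed.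

HB.instance Definition _ := isMeasure.Build _ _ _ lebesgue_rV_step
  step0 step_ge0 step_sigma_additive.

Let step_sigma_finite : sigma_finite setT lebesgue_rV_step.
Proof.
have /sigma_finiteP[F [FT ndF mF]] := sigma_finiteT (@lebesgue_measure R).
have /sigma_finiteP[G [GT ndG mG]] := sigma_finiteT mu.
exists (fun k => @rV_uncons n @^-1` (F k `*` G k)).
  rewrite -preimage_bigcup -[LHS](preimage_setT (@rV_uncons n)); congr preimage.
  apply/seteqP; split => -[x y] _ //=.
  have [k _ Fx] : (\bigcup_i F i) x by rewrite -FT.
  have [l _ Gy] : (\bigcup_i G i) y by rewrite -GT.
  exists (maxn k l) => //; split => /=.
  - by move: x Fx; exact/subsetPset/ndF/leq_maxl.
  - by move: y Gy; exact/subsetPset/ndG/leq_maxr.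
move=> k; have [mFk Fkoo] := mF k; have [mGk Gkoo] := mG k; split.
  rewrite -[X in measurable X]setTI; apply: measurable_rV_uncons => //.
  exact: measurableX.
rewrite /lebesgue_rV_step /pushforward -comp_preimage.
rewrite (_ : _ \o _ = id); last by apply/funext => p; exact: rV_consK.
by rewrite preimage_id product_measure1E// lte_mul_pinfty// ge0_fin_numE.
Qed.

HB.instance Definition _ := Measure_isSigmaFinite.Build _ _ _ lebesgue_rV_step
  step_sigma_finite.

End step.

(* Lebesgue measure on R^n, as the n-fold product of [lebesgue_measure]. *)
Fixpoint lebesgue_rV n : {sigma_finite_measure set 'rV[R]_n -> \bar R} :=
  match n with
  | 0 => \d_ (0 : 'rV[R]_0)
  | n'.+1 => lebesgue_rV_step (lebesgue_rV n')
  end.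

Definition rV_box n (a b : 'rV[R]_n) : set 'rV[R]_n :=
  [set x | forall i, a ord0 i < x ord0 i <= b ord0 i].

Lemma measurable_rV_box n (a b : 'rV[R]_n) : measurable (rV_box a b).
Proof.
rewrite (_ : rV_box a b = \bigcap_(i in [set: 'I_n])
    ((fun x : 'rV[R]_n => x ord0 i) @^-1` `]a ord0 i, b ord0 i])).
  apply: fin_bigcap_measurable => // i _.
  by rewrite -[X in measurable X]setTI; apply: measurable_rV_coor.
apply/seteqP; split => x /=; first by move=> + i _; move=> /(_ i).
by move=> + i => /(_ i I).
Qed.

Lemma lebesgue_rV_box n (a b : 'rV[R]_n) :
  (forall i, a ord0 i <= b ord0 i) ->
  lebesgue_rV n (rV_box a b) = (\prod_i (b ord0 i - a ord0 i))%:E.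
Proof.
elim: n a b => [|n IH] a b ab.
  rewrite /= diracE big_ord0 (_ : _ \in _)//.
  by rewrite inE => -[].
rewrite /= /lebesgue_rV_step /pushforward.
rewrite (_ : _ @^-1` _ = `]a ord0 ord0, b ord0 ord0] `*`
    rV_box (rV_uncons a).2 (rV_uncons b).2).
  rewrite product_measure1E//=; last exact: measurable_rV_box.
  rewrite lebesgue_measure_itv /= lte_fin big_ord_recl /=.
  rewrite IH => [|i]; last by rewrite !mxE.
  rewrite EFinM; congr (_ * _)%E.
    have := ab ord0; rewrite le_eqVlt => /predU1P[->|->]; last by rewrite EFinB.
    by rewrite ltxx subrr.
  by congr EFin; apply: eq_bigr => i _; rewrite !mxE.
apply/seteqP; split => -[y x] /=.
- move=> h; split => /=.
    by have := h ord0; rewrite rV_cons_ord0 in_itv.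
  by move=> i; have := h (lift ord0 i); rewrite rV_cons_lift !mxE.
- rewrite in_itv => -[/= h1 h2] i; case: (unliftP ord0 i) => [j ->|->].
    by rewrite rV_cons_lift; have := h2 j; rewrite !mxE.
  by rewrite rV_cons_ord0.
Qed.

End lebesgue_rV.

Section orthonormal_basis.
Context d (T : measurableType d) (R : realType).
Variable mu : {measure set T -> \bar R}.

Definition l2_inner (f g : T -> R) : R := \int[mu]_x (f x * g x).

Definition orthonormal_basis (I : choiceType) (e : I -> T -> R) : Prop :=
  [/\ forall i, e i \in Lfun mu 2%:E,
      forall i j, l2_inner (e i) (e j) = (i == j)%:R
    & forall f : T -> R, f \in Lfun mu 2%:E -> forall eps : R, 0 < eps ->
        exists (r : seq I) (c : I -> R),
          ('N[mu]_2%:E [EFin \o (fun x => f x - \sum_(i <- r) c i * e i x)%R]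
            < eps%:E)%E].

End orthonormal_basis.

Section wavelets.
Context {R : realType} {d : nat}.
Implicit Types f g phi : 'rV[R]_d -> R.

Definition partial (i : 'I_d) f : 'rV[R]_d -> R :=
  fun x => 'D_(delta_mx ord0 i) f x.

(* [:: i_1; ...; i_k] stands for the differential operator d_{i_1} ... d_{i_k};
   for a C^k function every multi-index of order k is of this form, up to the
   order of the derivatives, which is immaterial. *)
Definition partials (a : seq 'I_d) f : 'rV[R]_d -> R := foldr partial f a.

(* [`|x|] is the maximum norm; any other norm of R^d only changes C. *)
Definition regular (rho : nat) f : Prop :=
  [/\ forall a i x, (size a < rho)%N ->
        derivable (partials a f) x (delta_mx ord0 i),
      forall a, (size a <= rho)%N -> continuous (partials a f)
    & forall m : nat, exists C : R, forall a x, (size a <= rho)%N ->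
        `|partials a f x| <= C * (1 + `|x|) ^- m].

Definition scaled (j : nat) (k : 'rV[R]_d) g : 'rV[R]_d -> R :=
  fun x => 2 `^ ((j * d)%N%:R / 2) * g (2 ^+ j *: x - k).

Definition wavelet_system phi (psibar : 'I_(2 ^ d).-1 -> 'rV[R]_d -> R)
    (i : 'rV[int]_d + nat * 'I_(2 ^ d).-1 * 'rV[int]_d) : 'rV[R]_d -> R :=
  match i with
  | inl k => fun x => phi (x - map_mx intr k)
  | inr (j, m, k) => scaled j (map_mx intr k) (psibar m)
  end.

(* This contains the multiresolution structure: let V_0 be spanned by the
   translates of phi and W_j by the functions [scaled j k (psibar m)]. Then V_0
   is the orthogonal complement of the sum of all W_j (j >= 0), so that the
   dilate V_J of V_0 by 2^J, the complement of the sum of the W_j with j >= J,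
   is the sum of V_0, W_0, ..., W_(J-1). *)
Definition wavelet_basis phi (psibar : 'I_(2 ^ d).-1 -> 'rV[R]_d -> R) : Prop :=
  orthonormal_basis (lebesgue_rV R d) (wavelet_system phi psibar).

(* The sum of g (x - n) over n in Z^d, as a limit over the cubes [-N, N]^d; it
   converges absolutely when g is regular. *)
Definition periodize g : 'rV[R]_d -> R :=
  fun x => limn (fun N : nat => \sum_(n : 'rV['I_(N.*2.+1)]_d)
    g (x - map_mx (fun a : 'I_(N.*2.+1) => a%:R - N%:R) n)).

Definition torus : set 'rV[R]_d := rV_box 0 (const_mx 1).

Lemma measurable_torus : measurable torus.
Proof. exact: measurable_rV_box. Qed.

Definition torus_measure : {measure set 'rV[R]_d -> \bar R} :=
  mrestr (lebesgue_rV R d) measurable_torus.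

(* The mother wavelets are numbered from 0 and [psi] from 1 ([psi 0] is
   irrelevant). Functions on the torus are represented by functions on R^d;
   [torus_measure] only sees (0, 1]^d. *)
Definition torus_wavelet_basis (rho : nat) (psi : nat -> 'rV[R]_d -> R)
    : Prop :=
  exists (phi : 'rV[R]_d -> R) (psibar : 'I_(2 ^ d).-1 -> 'rV[R]_d -> R),
  [/\ wavelet_basis phi psibar,
      regular rho phi /\ forall m, regular rho (psibar m),
      psi 1%N = periodize phi,
      forall j : nat, exists2 e : 'I_(2 ^ (j.+1 * d) - 2 ^ (j * d)) ->
          'I_(2 ^ d).-1 * 'rV['I_(2 ^ j)]_d,
        bijective e
        & forall i : 'I_(2 ^ (j.+1 * d) - 2 ^ (j * d)),
            psi (2 ^ (j * d) + i.+1)%N =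
            periodize (scaled j (map_mx (fun a : 'I_(2 ^ j) => a%:R) (e i).2)
                         (psibar (e i).1))
    & orthonormal_basis torus_measure (fun l => psi l.+1)].

Definition wavelet_coef (psi : nat -> 'rV[R]_d -> R) f (l : nat) : R :=
  l2_inner torus_measure f (psi l).

Definition holder_norm (psi : nat -> 'rV[R]_d -> R) (t : R) f : \bar R :=
  ereal_sup [set (l%:R `^ (t / d%:R + 2^-1) * `|wavelet_coef psi f l|)%:E
            | l in [set l | (0 < l)%N]].

End wavelets.

Section random_series.
Context {disp : measure_display} {Omega : measurableType disp} {R : realType}.
Context {P : probability Omega R}.
Implicit Types xi : nat -> {RV P >-> R}.

Definition independent_rvs (I : set nat) xi : Prop :=
  forall (r : seq nat) (B : nat -> set R), uniq r -> {subset r <= I} ->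
    (forall l, measurable (B l)) ->
    P (\bigcap_(l in [set` r]) xi l @^-1` B l) =
    (\prod_(l <- r) P (xi l @^-1` B l))%E.

Definition has_density (X : {RV P >-> R}) (p : R -> R) : Prop :=
  forall A : set R, measurable A ->
    distribution P X A = (\int[lebesgue_measure]_(x in A) (p x)%:E)%E.

Definition iid_exp_power (q : R) xi : Prop :=
  independent_rvs [set l | (0 < l)%N] xi /\
  exists2 c : R, 0 < c & forall l, (0 < l)%N ->
    has_density (xi l) (fun x => c * expR (- (`|x| `^ q) / 2)).

(* The sum of the series is taken pointwise in x and w, with [xi 0] unused. *)
Definition random_function {d : nat} (q s kappa : R) xi
    (psi : nat -> 'rV[R]_d -> R) (w : Omega) : 'rV[R]_d -> R :=
  fun x => limn (fun n : nat => \sum_(1 <= l < n)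
    l%:R `^ (- (s / d%:R + 2^-1 - q^-1)) * (kappa^-1) `^ (q^-1) * xi l w
      * psi l x).

End random_series.

(* Main.v *)
(* By the decay of the wavelets, the sum of |psi_l| over the scale j is
   O(2^(jd/2)) uniformly in x. A series with coefficients O(l^(-1/2-eta)) then
   converges boundedly, so that its wavelet coefficients are the given ones.
   Hence alpha * norm is the supremum over l of
   alpha kappa^(-1/q) l^(-delta) |xi_l| for some delta > 0. Young's inequality
   bounds it by C + y^q / 8 with y = sup l^(-delta) |xi_l|; this is where
   alpha <= kappa / 8 is needed when q = 1. Finally exp(y^q / 8) is at most
   e + sum_l exp(|xi_l|^q / 4 - l^(delta q) / 8), whose expectation is finite.
   At a point where this series is finite, xi_l = O(l^delta), so that the random series
   converges there; elsewhere the bound is infinite. *)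
Require Import Defs.
From mathcomp Require Import all_boot all_order all_algebra.
From mathcomp Require Import all_classical all_reals all_analysis.
From mathcomp Require Import measurable_realfun ring lra.

Set Implicit Arguments.
Unset Strict Implicit.
Unset Printing Implicit Defensive.
Import Order.TTheory GRing.Theory Num.Theory.
Import numFieldNormedType.Exports.

Local Open Scope classical_set_scope.
Local Open Scope ring_scope.

(** * Sums of polynomially decaying functions over lattices *)

(* [v / (1 + |v|)] is a bounded function whose increments dominate
   [(1 + |v|)^-2] up to a factor 2. *)
Lemma inv_sqr_le_telescope (R : realFieldType) (v : R) :
  (1 + `|v|) ^- 2 <= 2 * ((v + 1) / (1 + `|v + 1|) - v / (1 + `|v|)).
Proof.
have h (a : R) : 0 <= a ->
    (1 + a) ^- 2 <= 2 * ((a + 1) / (1 + (a + 1)) - a / (1 + a)) /\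
    (1 + (a + 1)) ^- 2 <= 2 * ((a + 1) / (1 + (a + 1)) - a / (1 + a)).
  move=> a0.
  have p1 : 0 < 1 + a by lra.
  have p2 : 0 < 1 + (a + 1) by lra.
  have -> : 2 * ((a + 1) / (1 + (a + 1)) - a / (1 + a)) =
      2 / ((1 + a) * (1 + (a + 1))) :> R.
    by field; rewrite !gt_eqF.
  rewrite ler_pdivlMr ?mulr_gt0// ler_pdivlMr ?mulr_gt0//.
  split; rewrite mulrC ler_pdivrMr ?exprn_gt0//; nra.
have [v0|v0] := leP 0 v.
  rewrite !ger0_norm//; last lra.
  exact: (h v v0).1.
have [v1|v1] := leP 0 (v + 1); last first.
  have := (h (- v - 1) ltac:(lra)).2.
  rewrite (ltr0_norm v0) (ltr0_norm v1) subrK.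
  have -> : 1 + (- v - 1) = 1 + - (v + 1) by lra.
  by lra.
rewrite (ltr0_norm v0) (ger0_norm v1).
have p1 : 0 < 1 - v by lra.
have p2 : 0 < 1 + (v + 1) by lra.
have -> : 2 * ((v + 1) / (1 + (v + 1)) - v / (1 + - v)) =
  2 * ((v + 1) * (1 - v) - v * (1 + (v + 1))) / ((1 - v) * (1 + (v + 1))) :> R.
  by field; rewrite !gt_eqF.
apply: (@le_trans _ _ 1).
  rewrite invf_le1 ?exprn_gt0// exprn_ege1//; lra.
rewrite ler_pdivlMr ?mulr_gt0//; nra.
Qed.

Lemma sum_inv_sqr_le (R : realFieldType) (v : R) (b : nat) :
  \sum_(k < b) (1 + `|v + k%:R|) ^- 2 <=
  2 * ((v + b%:R) / (1 + `|v + b%:R|) - v / (1 + `|v|)).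
Proof.
elim: b => [|b IH]; first by rewrite big_ord0 addr0 subrr mulr0.
rewrite big_ord_recr/=; have := inv_sqr_le_telescope (v + b%:R).
by rewrite -addrA natr1 => h; lra.
Qed.

(** The numbers [b * n + k] run once through the integers from 0 to [b * M - 1], so the blocks
    telescope together. Since [v / (1 + |v|)] stays in [-1, 1], the bound is uniform in [v], [b] and
    [M]. *)
Lemma sum2_inv_sqr_le4 (R : realFieldType) (v : R) (b M : nat) :
  \sum_(n < M) \sum_(k < b) (1 + `|v + (b * n)%N%:R + k%:R|) ^- 2 <= 4.
Proof.
have h : \sum_(n < M) \sum_(k < b) (1 + `|v + (b * n)%N%:R + k%:R|) ^- 2 <=
    2 * ((v + (b * M)%N%:R) / (1 + `|v + (b * M)%N%:R|) - v / (1 + `|v|)).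
  elim: M => [|M IH]; first by rewrite big_ord0 muln0 addr0 subrr mulr0.
  rewrite big_ord_recr/=; have := sum_inv_sqr_le (v + (b * M)%N%:R) b.
  by rewrite -addrA -natrD -mulnSr => h; lra.
have F (a : R) : `|a / (1 + `|a|)| <= 1.
  have p : 0 < 1 + `|a| by rewrite ltr_pwDl.
  by rewrite normrM normfV (gtr0_norm p) ler_pdivrMr// mul1r lerDr.
have := F (v + (b * M)%N%:R); have := F v.
rewrite !ler_norml => /andP[? ?] /andP[? ?]; apply: (le_trans h); lra.
Qed.

Lemma ler_norm_coord (R : realType) (d : nat) (v : 'rV[R]_d) (i : 'I_d) :
  `|v ord0 i| <= `|v|.
Proof.
rewrite {2}/Num.Def.normr/= mx_normrE.
exact: (le_bigmax _ (fun ij : 'I_1 * 'I_d => `|v ij.1 ij.2|) (ord0, i)).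
Qed.

(** Each coordinate is bounded by the maximum norm, so decay of order 2d splits into d
    one-dimensional decays of order 2. *)
Lemma inv_norm_le_prod (R : realType) (d : nat) (v : 'rV[R]_d) :
  (1 + `|v|) ^- (2 * d) <= \prod_(i < d) (1 + `|v ord0 i|) ^- 2.
Proof.
rewrite exprM -exprVn -[X in _ ^+ X](card_ord d) -prodr_const.
apply: ler_prod => i _; rewrite invr_ge0 exprn_ge0 ?addr_ge0//=.
rewrite lef_pV2 ?posrE ?exprn_gt0 ?ltr_pwDl//.
by rewrite lerXn2r ?nnegrE ?addr_ge0// lerD2l ler_norm_coord.
Qed.

Lemma sum_rV_prod (R : comPzSemiRingType) (d b M : nat)
    (h : 'I_d -> 'I_b -> 'I_M -> R) :
  \sum_(k : 'rV['I_b]_d) \sum_(n : 'rV['I_M]_d)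
    \prod_(i < d) h i (k ord0 i) (n ord0 i) =
  \prod_(i < d) \sum_(k < b) \sum_(n < M) h i k n.
Proof.
under [RHS]eq_bigr => i _.
  rewrite pair_bigA/=; over.
rewrite bigA_distr_bigA pair_bigA/=.
rewrite (reindex (fun f : {ffun 'I_d -> 'I_b * 'I_M} =>
  (\row_i (f i).1, \row_i (f i).2) : 'rV['I_b]_d * 'rV['I_M]_d))/=.
  by apply: eq_bigr => f _; apply: eq_bigr => i _; rewrite !mxE.
exists (fun p : 'rV['I_b]_d * 'rV['I_M]_d =>
    [ffun i => (p.1 ord0 i, p.2 ord0 i)]) => [f _|p _].
  by apply/ffunP => i; rewrite ffunE/= !mxE -surjective_pairing.
rewrite [RHS]surjective_pairing.
by congr pair; apply/rowP => i; rewrite !mxE ffunE.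
Qed.

(* Componentwise, [b * n + k] runs once through an interval of integers, so
   that the double sum is at most a product of one-dimensional sums. *)
Lemma sum_lattice_le (R : realType) (d : nat) (C N : R) (g : 'rV[R]_d -> R)
    (hg : forall v, `|g v| <= C * (1 + `|v|) ^- (2 * d)) (x : 'rV[R]_d)
    (b M : nat) :
  \sum_(k : 'rV['I_b]_d) \sum_(n : 'rV['I_M]_d)
    `|g (b%:R *: (x - map_mx (fun a : 'I_M => a%:R - N) n)
         - map_mx (fun a : 'I_b => a%:R) k)| <= C * 4 ^+ d.
Proof.
have C0 : 0 <= C.
  have := le_trans (normr_ge0 _) (hg 0).
  by rewrite normr0 addr0 expr1n invr1 mulr1.
(* Coordinate [i] of the argument of [g], with its sign reversed, in the form needed by
   [sum2_inv_sqr_le4]. *)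
pose h i (k : 'I_b) (n : 'I_M) : R :=
  (1 + `|- (b%:R * (x ord0 i + N)) + (b * n)%N%:R + k%:R|) ^- 2.
apply: (@le_trans _ _ (\sum_(k : 'rV['I_b]_d) \sum_(n : 'rV['I_M]_d)
    C * \prod_(i < d) h i (k ord0 i) (n ord0 i))).
  apply: ler_sum => k _; apply: ler_sum => n _.
  apply: (le_trans (hg _)); rewrite ler_wpM2l//.
  apply: (le_trans (inv_norm_le_prod _)).
  rewrite le_eqVlt; apply/orP; left; apply/eqP; apply: eq_bigr => i _.
  rewrite /h !mxE natrM -[in RHS]normrN; congr ((1 + `|_|) ^- 2); ring.
under eq_bigr => k _ do rewrite -mulr_sumr.
rewrite -mulr_sumr ler_wpM2l// sum_rV_prod.
rewrite -[X in _ ^+ X](card_ord d) -prodr_const.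
apply: ler_prod => i _; apply/andP; split.
  by do 2 (apply: sumr_ge0 => ? _); rewrite invr_ge0 exprn_ge0 ?addr_ge0.
by rewrite exchange_big/=; exact: sum2_inv_sqr_le4.
Qed.

(** * Size of the periodized wavelets at one scale *)

(** By convention [limn] is 0 on a divergent sequence, so replacing each divergent [u i] by the zero
    sequence keeps all limits and only lowers the sums. *)
Lemma sum_norm_lim_le (R : realType) (I : finType) (u : I -> nat -> R) (B : R) :
  (forall N, \sum_i `|u i N| <= B) -> \sum_i `|limn (u i)| <= B.
Proof.
move=> uB; pose v i : nat -> R := if `[< cvgn (u i) >] then u i else fun=> 0.
have vu i : v i @ \oo --> limn (u i).
  rewrite /v; case: asboolP => // du.
  by rewrite dvgP//; exact: cvg_cst.
have vB : \sum_i `|v i N| @[N --> \oo] --> \sum_i `|limn (u i)|.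
  elim: (index_enum I) => [|i r IH].
    by rewrite big_nil; under eq_fun do rewrite big_nil; exact: cvg_cst.
  rewrite big_cons; under eq_fun do rewrite big_cons.
  by apply: cvgD => //; apply: cvg_norm; exact: vu.
apply: (@closed_cvg _ _ \oo _ _ [set y | y <= B]); [exact: closed_le| |exact: vB].
apply: nearW => N /=; apply: le_trans (uB N); apply: ler_sum => i _.
by rewrite /v; case: asboolP => //; rewrite normr0.
Qed.

(** The truncation at N is a lattice sum with b = 2^j and M = 2N+1; [sum_lattice_le] is uniform in
    M, so the bound survives the limit. *)
Lemma sum_periodize_le (R : realType) (d j : nat) (C : R) (g : 'rV[R]_d -> R)
    (hg : forall v, `|g v| <= C * (1 + `|v|) ^- (2 * d)) (x : 'rV[R]_d) :
  \sum_(k : 'rV['I_(2 ^ j)]_d)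
    `|periodize (scaled j (map_mx (fun a : 'I_(2 ^ j) => a%:R) k) g) x| <=
  2 `^ ((j * d)%N%:R / 2) * (C * 4 ^+ d).
Proof.
apply: sum_norm_lim_le => N.
apply: (@le_trans _ _ (\sum_(k : 'rV['I_(2 ^ j)]_d)
    \sum_(n : 'rV['I_(N.*2.+1)]_d) 2 `^ ((j * d)%N%:R / 2) *
    `|g ((2 ^ j)%:R *: (x - map_mx (fun a : 'I_(N.*2.+1) => a%:R - N%:R) n)
         - map_mx (fun a : 'I_(2 ^ j) => a%:R) k)|)).
  apply: ler_sum => k _; apply: le_trans (ler_norm_sum _ _ _) _.
  apply: ler_sum => n _; rewrite /scaled normrM natrX.
  by rewrite ger0_norm ?powR_ge0.
under eq_bigr => k _ do rewrite -mulr_sumr.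
by rewrite -mulr_sumr ler_wpM2l ?powR_ge0 ?sum_lattice_le.
Qed.

Lemma torus_wavelet_scale_le (R : realType) (d rho : nat)
    (psi : nat -> 'rV[R]_d -> R) : torus_wavelet_basis rho psi ->
  exists2 D : R, 0 <= D & forall x, `|psi 1 x| <= D /\
    forall j, \sum_(i < 2 ^ (j.+1 * d) - 2 ^ (j * d))
      `|psi (2 ^ (j * d) + i.+1)%N x| <= D * 2 `^ ((j * d)%N%:R / 2).
Proof.
move=> [phi [psibar [_ [rphi rpsi] psi1 psij _]]].
have decay (g : 'rV[R]_d -> R) : regular rho g ->
    exists C : R, forall v, `|g v| <= C * (1 + `|v|) ^- (2 * d).
  by move=> [_ _ /(_ (2 * d)%N)[C hC]]; exists C => v; exact: (hC [::]).
have [C0 hC0] := decay _ rphi.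
have /choice[C hC] : forall m, exists C : R,
  forall v, `|psibar m v| <= C * (1 + `|v|) ^- (2 * d) by move=> m; exact: decay.
have ge0 (g : 'rV[R]_d -> R) (K : R) :
    (forall v, `|g v| <= K * (1 + `|v|) ^- (2 * d)) -> 0 <= K.
  move=> h; have := le_trans (normr_ge0 _) (h 0).
  by rewrite normr0 addr0 expr1n invr1 mulr1.
have C00 := ge0 _ _ hC0.
have Cm0 m := ge0 _ _ (hC m).
exists ((C0 + \sum_m C m) * 4 ^+ d).
  by rewrite mulr_ge0// addr_ge0// sumr_ge0.
move=> x; split=> [|j].
  apply: (@le_trans _ _ (C0 * 4 ^+ d)); last first.
    by rewrite ler_wpM2r// lerDl sumr_ge0.
  (* The scaling function is treated as a function of scale 0, where the dilation is trivial and
     [k = 0] is the only shift. *)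
  have := sum_periodize_le 0 hC0 x.
  rewrite mul0n mul0r powRr0 mul1r; apply: le_trans.
  rewrite (bigD1 (const_mx ord0))//= -[leLHS]addr0 lerD ?sumr_ge0//.
  rewrite psi1 (_ : scaled _ _ _ = phi)//; apply/funext => y.
  rewrite /scaled mul0n mul0r powRr0 mul1r expr0 scale1r.
  rewrite (_ : map_mx _ _ = 0) ?subr0//.
  by apply/rowP => i; rewrite !mxE.
have [e be ehpsi] := psij j.
under eq_bigr => i _ do rewrite ehpsi.
pose F m (k : 'rV['I_(2 ^ j)]_d) : R :=
  `|periodize (scaled j (map_mx (fun a : 'I_(2 ^ j) => a%:R) k) (psibar m)) x|.
have <- : \sum_m \sum_k F m k = \sum_i F (e i).1 (e i).2.
  by rewrite pair_bigA (reindex e)//=; exact: onW_bij.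
apply: (@le_trans _ _ (\sum_m 2 `^ ((j * d)%N%:R / 2) * (C m * 4 ^+ d))).
  by apply: ler_sum => m _; exact: sum_periodize_le.
rewrite -mulr_sumr -mulr_suml mulrC ler_wpM2r ?powR_ge0//.
by rewrite ler_wpM2r// lerDr.
Qed.

(** * Convergence and coefficients of wavelet series *)

(** For 2^(Jd) < l <= 2^((J+1)d) the coefficients are at most A 2^(-Jd(1/2+eta)) and the wavelets
    sum to at most D 2^(Jd/2). The scale thus contributes at most A D z^J with z = 2^(-d eta) < 1, a
    geometric series. *)
Lemma wavelet_series_le (R : realType) (d rho : nat) (A eta : R)
    (psi : nat -> 'rV[R]_d -> R) (a : nat -> R) :
  (0 < d)%N -> 0 < eta -> torus_wavelet_basis rho psi ->
  (forall l, (0 < l)%N -> `|a l| <= A * l%:R `^ (- (2^-1 + eta))) ->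
  exists B, forall x n, \sum_(1 <= l < n) `|a l * psi l x| <= B.
Proof.
move=> d0 eta0 /torus_wavelet_scale_le[D D0 hD] ha.
pose z : R := 2 `^ (- (d%:R * eta)).
have z0 : 0 < z by rewrite powR_gt0.
have z1 : z < 1.
  rewrite /z powRN invf_lt1 ?powR_gt0//.
  have : (1 : R) `^ (d%:R * eta) < 2 `^ (d%:R * eta).
    by apply: gt0_ltr_powR; rewrite ?nnegrE ?ltr1n// mulr_gt0 ?ltr0n.
  by rewrite powR1.
have A0 : 0 <= A.
  by have := le_trans (normr_ge0 _) (ha 1%N isT); rewrite powR1 mulr1.
exists (A * D * (1 + (1 - z)^-1)) => x n.
have [D1 Dj] := hD x.
have block J : \sum_(1 <= l < (2 ^ (J * d)).+1) `|a l * psi l x| <=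
    A * D * (1 + (1 - z ^+ J) / (1 - z)).
  elim: J => [|J IH].
    rewrite big_nat1 expr0 subrr mul0r addr0 mulr1 normrM ler_pM//.
    by have := ha 1%N isT; rewrite powR1 mulr1.
  rewrite (@big_cat_nat _ _ _ (2 ^ (J * d)).+1)//=; last first.
    by rewrite ltnS leq_exp2l// leq_mul2r leqnSn orbT.
  have -> : A * D * (1 + (1 - z ^+ J.+1) / (1 - z)) =
      A * D * (1 + (1 - z ^+ J) / (1 - z)) + A * D * z ^+ J.
    rewrite exprS; field; rewrite subr_eq0 eq_sym lt_eqF//.
  apply: lerD => //.
  rewrite -[X in \sum_(X <= _ < _) _]add0n big_addn subSS big_mkord.
  have zJ : z ^+ J * 2 `^ (- ((J * d)%:R / 2)) = (2 ^ (J * d))%:R `^ (- (2^-1 + eta)).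
    rewrite /z -powR_mulrn ?powR_ge0// -powRrM -powRD ?pnatr_eq0 ?implybT//.
    rewrite natrX -powR_mulrn// -powRrM natrM; congr (_ `^ _); ring.
  apply: (@le_trans _ _ (\sum_(i < 2 ^ (J.+1 * d) - 2 ^ (J * d))
      A * (z ^+ J * 2 `^ (- ((J * d)%:R / 2))) * `|psi (2 ^ (J * d) + i.+1)%N x|)).
    apply: ler_sum => i _; rewrite addnS -addSn addnC normrM ler_wpM2r//.
    apply: (le_trans (ha _ _)); first by rewrite addnS.
    rewrite ler_wpM2l// zJ !powRN lef_pV2 ?posrE ?powR_gt0 ?ltr0n ?expn_gt0 ?addnS//.
    rewrite ge0_ler_powR ?nnegrE ?addr_ge0 ?(ltW eta0)//.
    by rewrite ler_nat -addnS leq_addr.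
  rewrite -mulr_sumr; apply: le_trans (ler_wpM2l _ (Dj J)) _.
    by rewrite !mulr_ge0// ?exprn_ge0 ?powR_ge0 ?ltW.
  rewrite powRN.
  have p : 2 `^ ((J * d)%:R / 2) != 0 :> R by rewrite gt_eqF ?powR_gt0.
  rewrite le_eqVlt; apply/orP; left; apply/eqP; field.
  exact: p.
(* As n <= 2^(nd), the sum can be enlarged to whole scales. *)
apply: (@le_trans _ _ (\sum_(1 <= l < (2 ^ (n * d)).+1) `|a l * psi l x|)).
  case: n => [|n]; first by rewrite big_geq// sumr_ge0.
  rewrite [leRHS](@big_cat_nat _ _ _ n.+1)//= ?lerDl ?sumr_ge0// ltnS.
  rewrite (leq_trans _ (leq_pexp2l _ (leq_pmulr n.+1 d0)))//.
  by rewrite (leq_trans (leqnSn n))// ltnW// ltn_expl.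
apply: (le_trans (block n)); rewrite ler_wpM2l ?mulr_ge0// lerD2l.
by rewrite ler_pdivrMr ?subr_gt0// mulVf ?subr_eq0 ?gt_eqF// gerBl exprn_ge0// ltW.
Qed.
Lemma torus_measure_setT (R : realType) (d : nat) :
  torus_measure [set: 'rV[R]_d] = 1%E.
Proof.
rewrite /torus_measure/= /mrestr setTI lebesgue_rV_box => [|i].
  by rewrite big1// => i _; rewrite !mxE subr0.
by rewrite !mxE ler01.
Qed.

(** Dominated convergence for the partial sums times [psi l.+1], with majorant [B * |psi l.+1|],
    integrable because the torus has finite measure. By orthonormality the integrals equal [a l.+1]
    once the partial sum contains that index. *)
Lemma wavelet_coef_series (R : realType) (d rho : nat) (A eta : R)
    (psi : nat -> 'rV[R]_d -> R) (a : nat -> R) (l : nat) :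
  (0 < d)%N -> 0 < eta -> torus_wavelet_basis rho psi ->
  (forall k, (0 < k)%N -> `|a k| <= A * k%:R `^ (- (2^-1 + eta))) ->
  wavelet_coef psi (fun x => limn (fun n => \sum_(1 <= k < n) a k * psi k x))
    l.+1 = a l.+1.
Proof.
move=> d0 eta0 psiP ha.
have [B hB] := wavelet_series_le d0 eta0 psiP ha.
have [_ [_ [_ _ _ _ [L2 orth _]]]] := psiP.
pose mu := @torus_measure R d.
have muT : mu setT \is a fin_num by rewrite torus_measure_setT.
have mpsi k : measurable_fun setT (psi k.+1).
  by move: (L2 k); rewrite inE => /andP[]; rewrite inE.
have ipsi k : mu.-integrable setT (EFin \o (fun x => psi k.+1 x * psi l.+1 x)).
  by apply/Lfun1_integrable; apply: Lfun2_mul_Lfun1; exact: L2.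
have psiE k : (\int[mu]_x (psi k.+1 x * psi l.+1 x)%:E = (k == l)%:R%:E)%E.
  have := orth k l; rewrite /l2_inner /Rintegral => <-.
  by rewrite fineK//; apply: integrable_fin_num => //; exact: ipsi.
(* The orthonormal basis starts at [psi 1]; the shifted index explains the [n.-1] terms. *)
pose f n x := \sum_(k < n.-1) a k.+1 * psi k.+1 x.
have fE n x : \sum_(1 <= k < n) a k * psi k x = f n x.
  by rewrite big_add1 big_mkord.
have cf x : f ^~ x @ \oo --> limn (f ^~ x).
  suff : cvgn (series (fun k => a k.+1 * psi k.+1 x)).
    move=> /cvg_ex[/= v hv]; apply/cvg_ex; exists v; rewrite -cvg_shiftS /f /=.
    by under eq_fun do rewrite -(big_mkord xpredT (fun k => a k.+1 * psi k.+1 x)).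
  apply: (@normed_cvg _ R^o); apply: nondecreasing_is_cvgn.
    by apply: nondecreasing_series => k _ _; exact: normr_ge0.
  exists B => _ [n _ <-]; apply: le_trans (hB x n.+1).
  by rewrite big_add1.
have mf n : measurable_fun setT (f n).
  by apply: measurable_sum => k; apply: measurable_funM.
have intf n : (l.+1 < n)%N -> (\int[mu]_x (f n x * psi l.+1 x)%:E = (a l.+1)%:E)%E.
  case: n => // n ln.
  under eq_integral => x _.
    rewrite /f mulr_suml -sumEFin.
    under eq_bigr do rewrite -mulrA EFinM.
    over.
  rewrite integral_sum//=; last by move=> k; apply: integrableZl => //; exact: ipsi.
  rewrite (bigD1 (Ordinal (ln : (l < n)%N)))//= integralZl//; last exact: ipsi.
  rewrite psiE eqxx mule1 big1 ?adde0// => k kl.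
  rewrite integralZl//; last exact: ipsi.
  by rewrite psiE (_ : _ == _ = false) ?mule0//; apply/negbTE.
have mlim : measurable_fun setT (fun x => limn (f ^~ x)).
  by apply: (measurable_fun_cvg mf) => x _; exact: cf.
have [] := @dominated_convergence _ _ R mu setT measurableT
  (fun n x => (f n x * psi l.+1 x)%:E) (fun x => (limn (f ^~ x) * psi l.+1 x)%:E)
  (fun x => B%:E * `|(psi l.+1 x)%:E|)%E.
- by move=> n; apply/measurable_EFinP; exact: measurable_funM.
- by apply/measurable_EFinP; exact: measurable_funM.
- apply: aeW => x _; apply: cvg_EFin; first exact: nearW.
  by apply: cvgMr_tmp; exact: cf.
- apply: integrableZl => //; apply: integrable_abse.
  by apply/Lfun1_integrable; apply: Lfun_subset12 => //; exact: L2.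
- apply: aeW => x n _; rewrite -EFinM/= lee_fin normrM ler_wpM2r//.
  rewrite -fE; apply: le_trans (hB x n); exact: ler_norm_sum.
move=> _ _ /= lim.
have : (\int[mu]_x (limn (f ^~ x) * psi l.+1 x)%:E = (a l.+1)%:E)%E.
  apply: (cvg_unique _ lim) => //.
  by apply: cvg_near_cst; exists l.+2 => // n ln; exact: intf.
rewrite /wavelet_coef /l2_inner /Rintegral.
under [in X in _ -> X]eq_integral do under eq_fun do rewrite fE.
by move=> ->.
Qed.

(** * Exponential moments of one random coefficient *)

(* The integral of a nonnegative function is a supremum over the simple
   functions below it, whether it is measurable or not. *)
Lemma le_integral_nonmeasurable d (T : measurableType d) (R : realType)
    (mu : {measure set T -> \bar R}) (f g : T -> \bar R) :
  (forall x, 0 <= f x)%E -> (forall x, f x <= g x)%E ->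
  (\int[mu]_x f x <= \int[mu]_x g x)%E.
Proof.
move=> f0 fg; rewrite !ge0_integralTE//; last first.
  by move=> x; apply: le_trans (fg x).
apply: le_ereal_sup => _ [h hf <-]; exists h => // x.
exact: le_trans (fg x).
Qed.

Lemma nneseries_le_ub (R : realType) (u : nat -> \bar R) (B : \bar R) :
  (forall n, 0 <= u n)%E -> (forall n, \sum_(k < n) u k <= B)%E ->
  (\sum_(k <oo) u k <= B)%E.
Proof.
move=> u0 uB; apply: lime_le; first by apply: is_cvg_nneseries => n _ _.
by apply: nearW => n; rewrite big_mkord.
Qed.

Lemma nneseries_geometric_le (R : realType) (M z : R) :
  0 <= M -> 0 <= z < 1 -> (\sum_(k <oo) (M * z ^+ k)%:E <= (M / (1 - z))%:E)%E.
Proof.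
move=> M0 /andP[z0 z1]; apply: nneseries_le_ub => n.
  by rewrite lee_fin mulr_ge0// exprn_ge0.
rewrite sumEFin lee_fin -mulr_sumr ler_wpM2l// -[leRHS]div1r ler_pdivlMr ?subr_gt0//.
by rewrite mulrC -[1 - z]opprB mulNr -subrX1 opprB gerBl exprn_ge0.
Qed.

(** On the shell the density is at most c exp(-n/2). As q >= 1, |x| is at most max(1, |x|^q), so the
    shell lies in [-(n+1), n+1]. *)
Lemma exp_power_shell_le (R : realType) (q c : R) (n : nat)
    (B := [set x : R | n%:R <= `|x| `^ q < n.+1%:R]) : 1 <= q -> 0 < c ->
  measurable B /\
  (\int[lebesgue_measure]_(x in B) (c * expR (- (`|x| `^ q) / 2))%:E
    <= (2 * c * n.+1%:R * expR (- n%:R / 2))%:E)%E.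
Proof.
move=> q1 c0.
have mq : measurable_fun setT (fun x : R => `|x| `^ q).
  by apply: (measurableT_comp (measurable_powR _)); exact: normr_measurable.
have mB : measurable B.
  rewrite (_ : B = (fun x : R => `|x| `^ q) @^-1` `[n%:R, n.+1%:R[).
    by rewrite -[X in measurable X]setTI; exact: mq.
  by apply/seteqP; split => x /=; rewrite in_itv.
split=> //.
apply: (@le_trans _ _ (\int[lebesgue_measure]_(x in B) (c * expR (- n%:R / 2))%:E)%E).
  apply: ge0_le_integral => //.
  - by move=> x _; rewrite lee_fin mulr_ge0 ?expR_ge0// ltW.
  - apply/measurable_EFinP/measurable_funM => //.
    apply: measurable_funTS; apply: measurableT_comp => //.
    by apply: measurable_funM => //; exact: measurableT_comp.
  - move=> x /= /andP[nx _]; rewrite lee_fin ler_pM2l// ler_expR.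
    by rewrite ler_wpM2r// lerN2.
rewrite integral_cst//; pose I : set R := [set` `[- n.+1%:R, n.+1%:R]].
apply: (@le_trans _ _ ((c * expR (- n%:R / 2))%:E * lebesgue_measure I)%E).
  apply: lee_wpmul2l; first by rewrite lee_fin mulr_ge0 ?expR_ge0// ltW.
  apply: le_measure; rewrite ?inE//; first exact: measurable_itv.
  move=> x /= /andP[_ xn]; rewrite /I/= in_itv/= -ler_norml; have [x1|x1] := leP `|x| 1.
    by rewrite (le_trans x1)// ler1n.
  by rewrite (le_trans (le1r_powR (ltW x1) q1))// ltW.
rewrite /I lebesgue_measure_itv/= lte_fin gtrN ?ltr0n// -EFinB -EFinM lee_fin.
by rewrite le_eqVlt; apply/orP; left; apply/eqP; ring.
Qed.

(** On the shell n <= |X|^q < n+1 the integrand is at most exp((n+1)/4), against a probability of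
    order (n+1) exp(-n/2). [K] is chosen before [X], so it serves all [xi l] at once. *)
Lemma exp_power_moment (R : realType) (disp : measure_display)
    (Omega : measurableType disp) (P : probability Omega R) (q c : R) :
  1 <= q -> 0 < c -> exists2 K : R, 0 <= K & forall X : {RV P >-> R},
    has_density X (fun x => c * expR (- (`|x| `^ q) / 2)) ->
    (\int[P]_w (expR (`|X w| `^ q / 4))%:E <= K%:E)%E.
Proof.
move=> q1 c0; pose z : R := expR (- 8^-1).
have z01 : 0 <= z < 1 by rewrite expR_ge0/= /z expR_lt1; lra.
pose M := 16 * c * expR (4^-1).
have M0 : 0 <= M by rewrite !mulr_ge0 ?expR_ge0 ?ltW.
exists (M / (1 - z)) => [|X hX].
  by rewrite divr_ge0// subr_ge0 ltW//; case/andP : z01.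
pose B n := [set x : R | n%:R <= `|x| `^ q < n.+1%:R].
pose A n := X @^-1` B n.
have mA n : measurable (A n).
  rewrite -[X in measurable X]setTI; apply: measurable_funP => //.
  by have [] := exp_power_shell_le n q1 c0.
pose g n w : \bar R := ((expR (n.+1%:R / 4))%:E * (\1_(A n) w)%:E)%E.
have g0 n w : (0 <= g n w)%E by rewrite /g -EFinM lee_fin mulr_ge0 ?expR_ge0.
apply: (@le_trans _ _ (\int[P]_w (\sum_(n <oo) g n w))%E).
  apply: le_integral_nonmeasurable => w; first by rewrite lee_fin expR_ge0.
  have /andP[n1 n2] := truncn_itv (powR_ge0 `|X w| q).
  set n := Num.truncn _ in n1 n2.
  apply: (@le_trans _ _ (g n w)).
    rewrite /g indicE mem_set ?mule1 ?lee_fin ?ler_expR; last by rewrite /A /B /= n1.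
    by rewrite ler_wpM2r// ltW.
  apply: (@le_trans _ _ (\sum_(0 <= i < n.+1) g i w)%E).
    by rewrite big_nat_recr//= leeDr// sume_ge0.
  exact: nneseries_lim_ge.
rewrite integral_nneseries//; last first.
  move=> n; apply: measurable_funeM; apply/measurable_EFinP; exact: measurable_indic.
apply: le_trans (nneseries_geometric_le M0 z01).
apply: lee_nneseries => n; first by move=> _ _; exact: integral_ge0.
move=> _; rewrite /g.
rewrite ge0_integralZl_EFin ?expR_ge0//; last first.
  by apply/measurable_EFinP; exact: measurable_indic.
rewrite integral_indic// setIT.
have [mB hB] := exp_power_shell_le n q1 c0.
rewrite -[X in (_ * X)%E]/(distribution P X (B n)) hX//; apply: le_trans (lee_wpmul2l _ hB) _.
  by rewrite lee_fin expR_ge0.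
rewrite -EFinM lee_fin /M /z -expRM_natl.
(* The polynomial factor costs exp(n/8), which leaves exp(-n/4 + n/8) = z^n; the 8 goes into [M]. *)
have n8 : n.+1%:R <= 8 * expR (n%:R / 8) :> R.
  have := expR_ge1Dx (n%:R / 8 : R); rewrite -(natr1 n); lra.
have -> : expR (n.+1%:R / 4) * (2 * c * n.+1%:R * expR (- n%:R / 2)) =
    2 * c * expR 4^-1 * expR (- n%:R / 4) * n.+1%:R :> R.
  have -> : expR (n.+1%:R / 4) = expR 4^-1 * expR (n%:R / 4) :> R.
    by rewrite -expRD -(natr1 n); congr expR; field.
  have -> : expR (- n%:R / 4) = expR (n%:R / 4) * expR (- n%:R / 2) :> R.
    by rewrite -expRD; congr expR; field.
  ring.
apply: (le_trans (ler_wpM2l _ n8)).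
  by rewrite !mulr_ge0 ?expR_ge0// ltW.
have -> : expR (n%:R * - 8^-1) = expR (- n%:R / 4) * expR (n%:R / 8) :> R.
  by rewrite -expRD; congr expR; field.
by rewrite le_eqVlt; apply/orP; left; apply/eqP; ring.
Qed.

(** * Scalar inequalities for the exponential bound *)

(** With gamma (n+1) >= 2, the term of order n+1 in the series of exp(L/8), for L = (l+1)^gamma,
    already dominates (l+1)^2 up to a constant. *)
Lemma expRN_powR_le (R : realType) (gamma : R) : 0 < gamma ->
  exists2 K : R, 0 <= K &
    forall l : nat, expR (- (l.+1%:R `^ gamma) / 8) <= K * (1 + l%:R) ^- 2.
Proof.
move=> g0; set n := (Num.truncn (2 / gamma)).
have n2 : 2 <= gamma * n.+1%:R.
  rewrite mulrC -ler_pdivrMr// ltW//.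
  by have /andP[] := truncn_itv (divr_ge0 (ler0n R 2) (ltW g0) : 0 <= 2 / gamma).
exists (n.+1`!%:R * 8 ^+ n.+1) => [|l]; first by rewrite mulr_ge0.
set L := l.+1%:R `^ gamma.
have L0 : 0 < L by rewrite powR_gt0.
have L2 : (1 + l%:R) ^+ 2 <= L ^+ n.+1.
  rewrite /L -powR_mulrn ?powR_ge0// -powRrM addrC natr1 -powR_mulrn//.
  by rewrite ler_powR// ler1n.
have h := expR_ge1Dxn n (divr_ge0 (ltW L0) (ler0n R 8)).
rewrite mulNr expRN -[leRHS]invrK lef_pV2 ?posrE ?expR_gt0//.
apply: le_trans h; rewrite invfM invrK.
apply: (@le_trans _ _ ((L / 8) ^+ n.+1 / n.+1`!%:R)); last by rewrite lerDr.
rewrite expr_div_n -mulrA -invfM [leLHS]mulrC (mulrC (8 ^+ n.+1)).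
by rewrite ler_wpM2r// invr_ge0 mulr_ge0.
Qed.

(** For q > 1 and y beyond [Y], y^(q-1) >= 8A, so the power alone suffices; below, A Y does. For q =
    1 both sides are linear, whence the condition on [A]. *)
Lemma powR_sub_bounded (R : realType) (q A : R) :
  1 <= q -> 0 <= A -> (q = 1 -> A <= 8^-1) ->
  exists C : R, forall y, 0 <= y -> A * y <= C + y `^ q / 8.
Proof.
move=> q1 A0 A8; have [q1'|q1'] := eqVneq q 1.
  exists 0 => y y0; rewrite q1' powRr1// add0r [y / 8]mulrC ler_wpM2r//.
  exact: A8.
have q0 : 0 < q - 1 by rewrite subr_gt0 lt_neqAle eq_sym q1'.
pose Y := (8 * A) `^ (q - 1)^-1.
exists (A * Y) => y y0; have [yY|Yy] := leP y Y.
  by rewrite (@le_trans _ _ (A * Y)) ?ler_wpM2l// lerDl divr_ge0// powR_ge0.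
rewrite (@le_trans _ _ (y `^ q / 8))//; last first.
  by rewrite lerDr mulr_ge0// powR_ge0.
rewrite -(mulr_powRB1 y0) ?(lt_le_trans ltr01)// ler_pdivlMr//.
rewrite mulrAC mulrC ler_wpM2l//.
have -> : A * 8 = Y `^ (q - 1).
  by rewrite /Y -powRrM mulVf ?gt_eqF// powRr1 ?mulr_ge0// mulrC.
by rewrite ge0_ler_powR ?nnegrE ?powR_ge0 ?(ltW q0)// ltW.
Qed.

(** If z <= L, the left side is at most exp(1/8). Otherwise z/L/8 <= z/8 = z/4 - z/8 < z/4 - L/8. *)
Lemma expR_div_le (R : realType) (z L : R) : 0 <= z -> 1 <= L ->
  expR (z / L / 8) <= expR 1 + expR (z / 4 - L / 8).
Proof.
move=> z0 L1; have L0 : 0 < L by exact: lt_le_trans L1.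
have [zL|Lz] := leP z L.
  apply: (@le_trans _ _ (expR 1)); last by rewrite lerDl expR_ge0.
  have : z / L <= 1 by rewrite ler_pdivrMr// mul1r.
  rewrite ler_expR; lra.
apply: (@le_trans _ _ (expR (z / 4 - L / 8))); last by rewrite lerDr expR_ge0.
have : z / L <= z by rewrite ler_pdivrMr// ler_peMr.
rewrite ler_expR; lra.
Qed.

(** * The majorizing random series *)

(** The second summand of [expR_div_le] at z = |xi|^q and L = (l+1)^gamma. *)
Definition moment_term (R : realType) (disp : measure_display)
    (Omega : measurableType disp) (P : probability Omega R) (q gamma : R)
    (xi : nat -> {RV P >-> R}) (w : Omega) (l : nat) : R :=
  expR (`|xi l.+1 w| `^ q / 4 - l.+1%:R `^ gamma / 8).

Lemma measurable_expR_power (R : realType) (disp : measure_display)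
    (Omega : measurableType disp) (P : probability Omega R) (q b : R)
    (X : {RV P >-> R}) :
  measurable_fun setT (fun w => (expR (`|X w| `^ q / 4 - b))%:E).
Proof.
apply/measurable_EFinP; apply: measurableT_comp => //.
apply: measurable_funB => //; apply: measurable_funM => //.
by apply: (measurableT_comp (measurable_powR _)); exact: measurableT_comp.
Qed.

(** Integrating termwise, each factor exp(|xi|^q/4) costs at most K, and the weights
    exp(-(l+1)^gamma/8) are summable. *)
Lemma moment_series_lty (R : realType) (disp : measure_display)
    (Omega : measurableType disp) (P : probability Omega R) (q gamma : R)
    (xi : nat -> {RV P >-> R}) :
  1 <= q -> 0 < gamma -> iid_exp_power q xi ->
  (\int[P]_w \sum_(l <oo) (moment_term q gamma xi w l)%:E < +oo)%E.
Proof.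
move=> q1 g0 [_ [c c0 hxi]].
have [K K0 hK] := exp_power_moment P q1 c0.
have [M M0 hM] := expRN_powR_le g0.
pose X l w : \bar R := (expR (`|xi l.+1 w| `^ q / 4))%:E.
have mX l : measurable_fun setT (X l).
  have := measurable_expR_power q 0 (xi l.+1).
  by under eq_fun do rewrite subr0.
have tE l w : (moment_term q gamma xi w l)%:E =
    ((expR (- (l.+1%:R `^ gamma) / 8))%:E * X l w)%E.
  by rewrite /moment_term expRD -EFinM mulrC mulNr.
rewrite integral_nneseries//; first last.
- by move=> l w _; rewrite lee_fin expR_ge0.
- by move=> l; exact: measurable_expR_power.
apply: (@le_lt_trans _ _ (M * K * 4)%:E); last exact: ltry.
apply: nneseries_le_ub => n.
  by apply: integral_ge0 => w _; rewrite lee_fin expR_ge0.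
apply: (@le_trans _ _ (\sum_(l < n) (M * (1 + `|0 + 0 + l%:R|) ^- 2 * K)%:E)%E).
  apply: lee_sum => l _; under eq_integral do rewrite tE.
  rewrite ge0_integralZl_EFin ?expR_ge0//; last by move=> w _; rewrite lee_fin expR_ge0.
  rewrite EFinM lee_pmul ?lee_fin ?expR_ge0//.
  - by apply: integral_ge0 => w _; rewrite lee_fin expR_ge0.
  - by rewrite !add0r ger0_norm//; exact: hM.
  - by apply: hK; exact: hxi.
rewrite sumEFin lee_fin -mulr_suml -mulr_sumr mulrAC ler_wpM2l ?mulr_ge0//.
have := sum2_inv_sqr_le4 (0 : R) n 1.
by rewrite big_ord1 muln0.
Qed.

(** Each term is at most the sum z, so exp(x) >= 1 + x gives |xi|^q <= 4z - 4 + L/2 with L =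
    (l+1)^gamma >= 1. This is at most (4z+1) L; take q-th roots. *)
Lemma moment_series_power_le (R : realType) (disp : measure_display)
    (Omega : measurableType disp) (P : probability Omega R) (q gamma : R)
    (xi : nat -> {RV P >-> R}) (w : Omega) :
  1 <= q -> 0 < gamma ->
  (\sum_(l <oo) (moment_term q gamma xi w l)%:E < +oo)%E ->
  exists z : R, [/\ 0 <= z,
    forall l, moment_term q gamma xi w l <= z,
    (\sum_(l <oo) (moment_term q gamma xi w l)%:E = z%:E)%E
    & forall l, `|xi l.+1 w| <= (4 * z + 1) `^ q^-1 * l.+1%:R `^ (gamma / q)].
Proof.
move=> q1 g0 Zoo; have q0 : 0 < q := lt_le_trans ltr01 q1.
have term0 l : (0 <= (moment_term q gamma xi w l)%:E)%E by rewrite lee_fin expR_ge0.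
have Z0 : (0 <= \sum_(l <oo) (moment_term q gamma xi w l)%:E)%E.
  by apply: nneseries_ge0 => l _ _.
have Zfin : (\sum_(l <oo) (moment_term q gamma xi w l)%:E)%E \is a fin_num.
  by rewrite ge0_fin_numE.
exists (fine (\sum_(l <oo) (moment_term q gamma xi w l)%:E)%E).
set z := fine _; have zE : (\sum_(l <oo) (moment_term q gamma xi w l)%:E = z%:E)%E.
  by rewrite fineK.
have z0 : 0 <= z by rewrite fine_ge0.
have termz l : moment_term q gamma xi w l <= z.
  rewrite -lee_fin -zE.
  apply: (@le_trans _ _ (\sum_(0 <= i < l.+1) (moment_term q gamma xi w i)%:E)%E).
    by rewrite big_nat_recr//= leeDr// sume_ge0.
  exact: nneseries_lim_ge.
split=> // l.
have L1 : 1 <= l.+1%:R `^ gamma.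
  by rewrite -[leLHS](powRr0 l.+1%:R) ler_powR ?ler1n// ltW.
have h : `|xi l.+1 w| `^ q <= (4 * z + 1) * l.+1%:R `^ gamma.
  have := le_trans (expR_ge1Dx _) (termz l).
  have : z <= z * l.+1%:R `^ gamma by rewrite ler_peMr.
  lra.
rewrite powRrM -powRM ?powR_ge0 ?addr_ge0 ?mulr_ge0//.
have -> : `|xi l.+1 w| = (`|xi l.+1 w| `^ q) `^ q^-1.
  by rewrite -powRrM mulfV ?gt_eqF// powRr1.
apply: ge0_ler_powR; rewrite ?nnegrE ?powR_ge0 ?mulr_ge0 ?powR_ge0 ?addr_ge0 ?mulr_ge0//.
by rewrite invr_ge0 ltW.
Qed.

(** * Exponential integrability of the Hölder norm *)

Theorem theorem2p1 (R : realType) (d : nat) (q s t : R)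
    (hd : (0 < d <= 3)%N) (hq : 1 <= q) (hs : d%:R / q < s)
    (ht : t < s - d%:R / q) :
  exists2 r : R, 0 < r &
    forall (kappa : R) (rho : nat) (psi : nat -> 'rV[R]_d -> R)
      (disp : measure_display) (Omega : measurableType disp)
      (P : probability Omega R) (xi : nat -> {RV P >-> R}),
    0 < kappa -> s < rho%:R -> torus_wavelet_basis rho psi ->
    iid_exp_power q xi ->
    forall alpha : R, 0 < alpha < kappa / (2 * r) ->
      (\int[P]_w expeR (alpha%:E *
         holder_norm psi t (random_function q s kappa xi psi w)) < +oo)%E.
Proof.
(* With r = 4, alpha < kappa/8; for q = 1 this makes alpha/kappa at most 1/8, as [powR_sub_bounded]
   requires. *)
exists 4 => // kappa rho psi disp Omega P xi k0 _ psiP xiP alpha /andP[a0 ak].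
have q0 : 0 < q := lt_le_trans ltr01 hq.
have d0 : (0 < d)%N by case/andP: hd.
have dR : 0 < d%:R :> R by rewrite ltr0n.
(* The norm increases with [t], which may thus be assumed positive. *)
have [t' [tt' t'0 t's]] : exists t', [/\ t <= t', 0 < t' & t' < s - d%:R / q].
  exists (Num.max t ((s - d%:R / q) / 2)).
  by rewrite le_max lexx lt_max gt_max ht; split => //; [apply/orP; right|]; lra.
(* [eta] is the decay of the coefficients beyond l^(-1/2), and [delta] the growth in l then allowed
   to |xi_l|; it is positive because t' < s - d/q. *)
pose eta := t' / d%:R; pose delta := s / d%:R - q^-1 - eta.
have eta0 : 0 < eta by rewrite divr_gt0.
have delta0 : 0 < delta.
  have -> : delta = (s - d%:R / q - t') / d%:R.
    by rewrite /delta /eta; field; rewrite !gt_eqF.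
  by rewrite divr_gt0// subr_gt0.
pose gamma := delta * q; have g0 : 0 < gamma by rewrite mulr_gt0.
pose k := kappa^-1 `^ q^-1.
have kpos : 0 < k by rewrite powR_gt0// invr_gt0.
have [C hC] : exists C : R, forall y, 0 <= y -> alpha * k * y <= C + y `^ q / 8.
  apply: powR_sub_bounded => //; first by rewrite mulr_ge0 ?ltW.
  move=> q1; rewrite /k q1 invr1 powRr1 ?invr_ge0 ?(ltW k0)//.
  rewrite ler_pdivrMr//; lra.
pose Z w := (\sum_(l <oo) (moment_term q gamma xi w l)%:E)%E.
have mZ : measurable_fun setT Z.
  by apply: ge0_emeasurable_sum => // l *; [rewrite lee_fin expR_ge0|exact: measurable_expR_power].
have Z0 w : (0 <= Z w)%E.
  by apply: nneseries_ge0 => l _ _; rewrite lee_fin expR_ge0.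
have intZ : (\int[P]_w Z w < +oo)%E by exact: moment_series_lty.
apply: (@le_lt_trans _ _ (\int[P]_w ((expR C)%:E * ((expR 1)%:E + Z w)))%E); last first.
  rewrite ge0_integralZl_EFin ?expR_ge0//; last 2 first.
  - by move=> w _; rewrite adde_ge0// lee_fin expR_ge0.
  - exact: emeasurable_funD.
  rewrite ge0_integralD//; try by move=> w _; rewrite lee_fin expR_ge0.
  apply: lte_mul_pinfty; rewrite ?lee_fin ?expR_ge0//.
  rewrite integral_cst//= (_ : _ setT = 1%E) ?mule1; last exact: (@probability_setT _ _ _ P).
  by rewrite lte_add_pinfty// ltry.
apply: le_integral_nonmeasurable => w; first exact: expeR_ge0.
have [Zoo|] := ltP (Z w) +oo%E; last first.
  rewrite leye_eq => /eqP ->; rewrite addey// gt0_muley ?leey// lte_fin expR_gt0.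
  by [].
have [z [z0 termz zE xiz]] := moment_series_power_le hq g0 Zoo.
rewrite /Z zE.
pose a l := l%:R `^ (- (s / d%:R + 2^-1 - q^-1)) * k * xi l w.
(* At this [w], |xi_l| = O(l^delta) since gamma/q = delta, which leaves coefficients O(l^(-1/2-eta))
   with a constant depending on [z]. *)
have coefE l : wavelet_coef psi (random_function q s kappa xi psi w) l.+1 = a l.+1.
  apply: (wavelet_coef_series (A := k * (4 * z + 1) `^ q^-1) _ d0 eta0 psiP).
  case=> // n _; rewrite /a !normrM (gtr0_norm kpos) ger0_norm ?powR_ge0//.
  have -> : - (2^-1 + eta) = - (s / d%:R + 2^-1 - q^-1) + gamma / q.
    by rewrite /gamma mulfK ?gt_eqF// /delta; ring.
  rewrite powRD ?pnatr_eq0 ?implybT//.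
  rewrite [leRHS](_ : _ = n.+1%:R `^ (- (s / d%:R + 2^-1 - q^-1)) * k *
    ((4 * z + 1) `^ q^-1 * n.+1%:R `^ (gamma / q))); last ring.
  by rewrite ler_wpM2l// mulr_ge0 ?powR_ge0// ltW.
have normle : (holder_norm psi t (random_function q s kappa xi psi w) <=
   ((C + ln (expR 1 + z)) / alpha)%:E)%E.
  apply: ge_ereal_sup => _ [[|l]// _ <-]; rewrite lee_fin coefE.
  rewrite ler_pdivlMr//.
  pose y := l.+1%:R `^ (- delta) * `|xi l.+1 w|.
  have y0 : 0 <= y by rewrite mulr_ge0 ?powR_ge0.
  (* Since t/d <= eta, the exponents of the weight and of the coefficient add up to at most
     -delta. *)
  have le1 : l.+1%:R `^ (t / d%:R + 2^-1) * `|a l.+1| <= k * y.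
    rewrite /a /y !normrM (gtr0_norm kpos) ger0_norm ?powR_ge0// !mulrA.
    rewrite ler_wpM2r// [leRHS]mulrC ler_wpM2r ?(ltW kpos)//.
    rewrite -powRD ?pnatr_eq0 ?implybT// ler_powR ?ler1n//.
    have : t / d%:R <= eta by rewrite ler_wpM2r// invr_ge0 ltW.
    rewrite /delta; lra.
  (* A single term of the series is at most [z], so the bound does not depend on [l] and passes to
     the supremum. *)
  have le2 : y `^ q / 8 <= ln (expR 1 + z).
    rewrite -ler_expR lnK ?posrE ?ltr_pwDl ?expR_gt0//.
    have -> : y `^ q = `|xi l.+1 w| `^ q / l.+1%:R `^ gamma.
      rewrite powRM ?powR_ge0// -powRrM mulrC; congr (_ * _).
      by rewrite mulNr powRN.
    apply: le_trans (expR_div_le (powR_ge0 _ _) _) _;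
      last by rewrite lerD2l; exact: termz.
    by rewrite -[leLHS](powRr0 l.+1%:R) ler_powR ?ler1n// ltW.
  rewrite mulrC; apply: le_trans (ler_wpM2l (ltW a0) le1) _.
  by rewrite mulrA; apply: le_trans (hC _ y0) _; rewrite lerD2l.
apply: (@le_trans _ _ (expeR (C + ln (expR 1 + z))%:E)).
  rewrite lee_expeR; apply: le_trans (lee_wpmul2l _ normle) _.
    by rewrite lee_fin ltW.
  by rewrite -EFinM mulrC divfK ?gt_eqF.
by rewrite /= -EFinD -EFinM lee_fin expRD lnK// posrE ltr_pwDl ?expR_gt0.
Qed.
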